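(* Let $X=\prod_{n\ge1}\{0,1,\dots,2^n-1\}$ with the product $\sigma$-algebra and the product measure $\mu=\bigotimes_{n\ge1}\mu_n$, where $\mu_n(i)=2^{-n}$ for $0\le i\le 2^n-1$. For $x=(x_n)_{n\ge1}\in X$ let $N(x)=\min\{n\ge1: x_n<2^n-1\}$ (defined for a.e. $x$), and let $T:X\to X$ be the odometer defined for a.e. $x$ by $(Tx)_n=0$ if $n<N(x)$, $(Tx)_n=x_n+1$ if $n=N(x)$, and $(Tx)_n=x_n$ if $n>N(x)$. Let $K_n=1!\,2!\cdots n!$ for $n\ge4$, and define $f:X\to\mathbb{R}$ for a.e. $x$ by $f(x)=K_{2^{N+1}+x_{N+1}}$, where $N=N(x)$. Let $\{F_t\}_{t\in\mathbb{R}}$ be the flow built under the function $f$ with base automorphism $T$. Then $\{F_t\}_{t\in\mathbb{R}}$ satisfies Property B.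
   Context: The flow built under the function $f$ with base automorphism $T$ is defined on $Y=\{(x,u)\in X\times\mathbb{R}:0\le u<f(x)\}$ equipped with the restriction $\nu$ of $\mu\times\lambda$ ($\lambda$ Lebesgue measure), by: for $t>0$, $F_t(x,u)=(x,t+u)$ if $0\le t+u<f(x)$; $F_t(x,u)=(T(x),t+u-f(x))$ if $f(x)\le t+u<f(x)+f(T(x))$; and so on; $F_{-t}=F_t^{-1}$, $F_0=\mathrm{id}$. Property B: for a measurable flow $\{F_t\}_{t\in\mathbb{R}}$ of nonsingular automorphisms of $(Y,\nu)$, a measurable $A\subseteq Y$ of positive measure and $s,\delta>0$ let $\Lambda_{F,\delta,s}(A)=\{y\in A:\ \exists t\in(e^{s-\delta},e^{s+\delta})\cup(-e^{s+\delta},-e^{s-\delta}),\ F_t(y)\in A\}$. The flow has Property B if there exists a measurable set $A\subseteq Y$ of positive measure such that for all $\delta>0$, $\limsup_{s\to\infty}\nu(\Lambda_{F,\delta,s}(A))=0$. *)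

(* Defs.v *)
From HB Require Import structures.
From mathcomp Require Import all_boot all_order all_algebra.
From mathcomp Require Import all_classical all_reals all_analysis.
From mathcomp Require Import measurable_realfun.

Set Implicit Arguments.
Unset Strict Implicit.
Unset Printing Implicit Defensive.

Import Order.TTheory GRing.Theory Num.Theory.
Import numFieldNormedType.Exports.

Local Open Scope classical_set_scope.
Local Open Scope ring_scope.

Section flow_under_function.
Context {R : realType} {X : pointedType} (T : X -> X) (f : X -> R).

Definition suspension : set (X * R) := [set y | 0 <= y.2 < f y.1].

Definition height (k : nat) (x : X) : R := \sum_(i < k) f (iter i T x).

(* The index of the level reached is unique when f > 0; the default 0 is only
   used when the forward sums of f stay bounded by t + u. *)
Definition flow_level (t : R) (y : X * R) : nat :=
  xget 0%N [set k | height k y.1 <= t + y.2 < height k.+1 y.1].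

Definition flow_fwd (t : R) (y : X * R) : X * R :=
  let k := flow_level t y in (iter k T y.1, t + y.2 - height k y.1).

Definition flow (t : R) (y : X * R) : X * R :=
  if 0 < t then flow_fwd t y
  else if t == 0 then y
  else pinv suspension (flow_fwd (- t)) y.

End flow_under_function.

Lemma measurable_suspension (R : realType) (d : measure_display)
    (X : measurableType d) (f : X -> R) :
  measurable_fun setT f -> measurable (suspension f).
Proof.
move=> mf.
have mle : measurable_fun setT (fun y : X * R => (0 : R) <= y.2).
  by apply: measurable_fun_ler; [exact: measurable_cst|exact: measurable_snd].
have mlt : measurable_fun setT (fun y : X * R => y.2 < f y.1).
  apply: measurable_fun_ltr; first exact: measurable_snd.
  exact: measurableT_comp mf measurable_fst.
rewrite (_ : suspension f = ((fun y : X * R => (0 : R) <= y.2) @^-1` [set true])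
    `&` ((fun y : X * R => y.2 < f y.1) @^-1` [set true])).
  apply: measurableI.
    by rewrite -[X in measurable X]setTI; exact: mle.
  by rewrite -[X in measurable X]setTI; exact: mlt.
by apply/seteqP; split => y /= /andP.
Qed.

Definition suspension_measure (R : realType) (d : measure_display)
    (X : measurableType d) (mu : {measure set X -> \bar R}) (f : X -> R)
    (mf : measurable_fun setT f) :
    {measure set (X * measurableTypeR R)%type -> \bar R} :=
  mrestr (mu \x @lebesgue_measure R)%E (measurable_suspension mf).

Section property_B.
Context {R : realType} {d : measure_display} {Z : measurableType d}.

Definition return_set (F : R -> Z -> Z) (delta s : R) (A : set Z) : set Z :=
  [set y | A y /\ exists t : R,
    (expR (s - delta) < t < expR (s + delta) \/
     - expR (s + delta) < t < - expR (s - delta)) /\ A (F t y)].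

(* Y is the phase space of the flow, as a subset of the ambient type Z.
   The set return_set F delta s A is a projection along the time parameter, so
   it need not belong to the sigma-algebra of Z: it is measured with the outer
   measure of nu, which agrees with nu on measurable sets and with the
   completion of nu on the completed sigma-algebra. *)
Definition property_B (nu : {measure set Z -> \bar R}) (Y : set Z)
    (F : R -> Z -> Z) : Prop :=
  exists A : set Z, [/\ measurable A, A `<=` Y, (0 < nu A)%E &
    forall delta : R, 0 < delta ->
      limf_esup (fun s : R => mu_ext nu (return_set F delta s A))
        (pinfty_nbhs R) = 0%E].

End property_B.

(* Indices are shifted by one: coordinate n here is x_(n+1) in {0..2^(n+1)-1},
   so that n ranges over all of nat. *)
Definition digits : Type := forall n : nat, 'I_(2 ^ n.+1).

Definition digits0 : digits := fun n => Ordinal (expn_gt0 2 n.+1).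

HB.instance Definition _ := Choice.on digits.
HB.instance Definition _ := isPointed.Build digits digits0.

Definition cylinders : set (set digits) :=
  [set A | exists (n : nat) (B : set 'I_(2 ^ n.+1)), A = [set x | B (x n)]].

Definition odoX := g_sigma_algebraType cylinders.

Definition digit_weight (R : realType) (n : nat) (B : {set 'I_(2 ^ n.+1)}) : R :=
  \sum_(i in B) 2 ^- n.+1.

(* By the pi-lambda theorem there is at most one such mu, namely the infinite
   product of the uniform probabilities. *)
Definition is_product_measure (R : realType)
    (mu : {measure set odoX -> \bar R}) : Prop :=
  forall (n : nat) (B : forall i : nat, {set 'I_(2 ^ i.+1)}),
    mu [set x : odoX | forall i, (i < n)%N -> x i \in B i]
    = (\prod_(i < n) digit_weight R (B i))%:E.

(* first_nonmax x = Some m stands for N(x) = m + 1, and None for the single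
   point all of whose digits are maximal. *)
Definition first_nonmax (x : odoX) : option nat :=
  if pselect (exists n, (x n < 2 ^ n.+1 - 1)%N) is left e
  then Some (ex_minn e) else None.

(* The all-maximal point is sent to the all-zero one, making the odometer a
   bijection; its value at this null point is otherwise irrelevant. *)
Definition odometer (x : odoX) : odoX :=
  if first_nonmax x is Some m then
    fun n => if (n < m)%N then digits0 n
             else if n == m then ordS (x n) else x n
  else digits0.

Definition superfact (n : nat) : nat := \prod_(1 <= i < n.+1) i`!.

(* With N(x) = m + 1, this is K_(2^(N+1) + x_(N+1)).  The value at the
   all-maximal point is arbitrary (but positive). *)
Definition roof (R : realType) (x : odoX) : R :=
  if first_nonmax x is Some m then (superfact (2 ^ m.+2 + x m.+1))%:R
  else (superfact 4)%:R.

Lemma measurable_digit (n : nat) (B : set 'I_(2 ^ n.+1)) :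
  measurable [set x : odoX | B (x n)].
Proof. by apply: sub_sigma_algebra; exists n, B. Qed.

Lemma first_nonmaxP (x : odoX) (m : nat) : first_nonmax x = Some m <->
  (x m < 2 ^ m.+1 - 1)%N /\ forall i, (i < m)%N -> ~~ (x i < 2 ^ i.+1 - 1)%N.
Proof.
rewrite /first_nonmax; case: pselect => [e|ne]; last first.
  by split=> // -[xm _]; case: ne; exists m.
case: ex_minnP => k xk kmin; split=> [[<-]|[xm mmin]].
  by split=> // i ik; apply/negP => /kmin; rewrite leqNgt ik.
congr Some; apply/eqP; rewrite eqn_leq kmin //= leqNgt.
by apply/negP => /mmin; rewrite xk.
Qed.

Lemma measurable_first_nonmax (m : nat) :
  measurable [set x : odoX | first_nonmax x = Some m].
Proof.
rewrite (_ : [set _ | _] = [set x : odoX | (x m < 2 ^ m.+1 - 1)%N] `&`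
    \bigcap_(i in [set i | (i < m)%N])
      [set x : odoX | ~~ (x i < 2 ^ i.+1 - 1)%N]).
  apply: measurableI; first exact: (measurable_digit
    [set j : 'I_(2 ^ m.+1) | (j < 2 ^ m.+1 - 1)%N]).
  apply: bigcap_measurableType => i _.
  exact: (measurable_digit [set j : 'I_(2 ^ i.+1) | ~~ (j < 2 ^ i.+1 - 1)%N]).
by apply/seteqP; split => x /first_nonmaxP.
Qed.

Lemma measurable_roof (R : realType) : measurable_fun setT (@roof R).
Proof.
move=> _ B mB; rewrite setTI.
rewrite (_ : _ @^-1` _ = (\bigcup_m ([set x | first_nonmax x = Some m] `&`
      [set x : odoX | B (superfact (2 ^ m.+2 + x m.+1))%:R])) `|`
    (~` (\bigcup_m [set x | first_nonmax x = Some m]) `&`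
      [set _ | B (superfact 4)%:R])).
  apply: measurableU.
    apply: bigcup_measurable => m _; apply: measurableI.
      exact: measurable_first_nonmax.
    exact: (measurable_digit
      [set j : 'I_(2 ^ m.+2) | B (superfact (2 ^ m.+2 + j))%:R]).
  apply: measurableI.
    apply: measurableC; apply: bigcup_measurable => m _.
    exact: measurable_first_nonmax.
  have [b|b] := pselect (B (superfact 4)%:R).
    by rewrite (_ : mkset _ = setT)//; apply/seteqP; split.
  by rewrite (_ : mkset _ = set0)//; apply/seteqP; split.
apply/seteqP; split => x /=; rewrite /roof.
  case E : (first_nonmax x) => [m|] Bx; first by left; exists m.
  by right; split=> // -[m _ /=]; rewrite E.
case=> [[m _ [/= -> //]]|[/= nx]].
by case E : (first_nonmax x) => [m|] // _; case: nx; exists m.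
Qed.

(* Main.v *)
Require Import Defs.
From mathcomp Require Import all_boot all_order all_algebra.
From mathcomp Require Import all_classical all_reals all_analysis.
From mathcomp Require Import lra.

Set Implicit Arguments.
Unset Strict Implicit.
Unset Printing Implicit Defensive.

Import Order.TTheory GRing.Theory Num.Theory.
Import numFieldNormedType.Exports.

Local Open Scope classical_set_scope.
Local Open Scope ring_scope.

(** The set A consists of the points whose base coordinate has infinitely many
    non-maximal digits and whose height lies strictly between 0 and 1. If a point
    (x, u) of A returns to A after a time t > 0, then t is within distance 1 of a
    sum of the roof along the orbit of x, and the same holds for t < 0 with the
    orbit segment that ends at x. So it must be shown that, for most x, no such
    sum falls into a window around exp s of fixed logarithmic width.

    The values K_M of the roof grow so fast that a sum of the roof is governed by
    its largest term. Let K_M be the largest value not exceeding the upper end of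
    the window, and write M = 2 ^ (m + 2) + j with j < 2 ^ (m + 2). A sum in the
    window has no term beyond K_M, so that along it the carry of the odometer
    never leaves the digits 0, ..., m; these digits count the steps
    ([radix_value_odometer]), so there are fewer steps than the product of the
    first m + 1 radices. This product times 2 ^ (m + 2) is at most M!
    ([radix_weight_le_fact]), so without the term K_M the sum would be less than
    K_M / 2 ^ (m + 2), which is below the window once m is large. Hence K_M
    occurs, which means that digit m + 1 equals j at some point of the orbit
    segment, and then at all its points, because no carry reaches this digit
    ([leading_term_digit]).

    Thus all points of A that return during the window lie in the strip over the
    event that digit m + 1 equals j ([return_digit]). The strip has measure
    2 ^- (m + 2), and m tends to infinity with s. *)

(** * The odometer as addition of one *)

Lemma odometer_lt (x : odoX) (p i : nat) :
  first_nonmax x = Some p -> (i < p)%N -> odometer x i = 0%N :> nat.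
Proof. by rewrite /odometer => -> ->. Qed.

Lemma odometer_eq (x : odoX) (p : nat) :
  first_nonmax x = Some p -> odometer x p = (x p).+1 :> nat.
Proof.
move=> xp; rewrite /odometer xp ltnn eqxx /= modn_small//.
have /first_nonmaxP[+ _] := xp.
by rewrite ltn_subRL add1n.
Qed.

Lemma odometer_gt (x : odoX) (p i : nat) :
  first_nonmax x = Some p -> (p < i)%N -> odometer x i = x i.
Proof.
by rewrite /odometer => -> pi; rewrite ltnNge (ltnW pi)/= gtn_eqF.
Qed.

(** The place value of digit [m] in the mixed radix system of the odometer; it
    is also the number of odometer steps in a full cycle of the first [m]
    digits. *)
Definition radix_weight (m : nat) : nat := \prod_(i < m) 2 ^ i.+1.

Lemma radix_weightS (m : nat) :
  radix_weight m.+1 = (radix_weight m * 2 ^ m.+1)%N.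
Proof. exact: big_ord_recr. Qed.

Definition radix_value (m : nat) (x : odoX) : nat :=
  \sum_(i < m) x i * radix_weight i.

Lemma radix_valueS (m : nat) (x : odoX) :
  radix_value m.+1 x = (radix_value m x + x m * radix_weight m)%N.
Proof. exact: big_ord_recr. Qed.

Lemma radix_value_lt (m : nat) (x : odoX) :
  (radix_value m x < radix_weight m)%N.
Proof.
elim: m => [|m IHm]; first by rewrite /radix_value /radix_weight !big_ord0.
rewrite radix_valueS radix_weightS [ltnRHS]mulnC.
apply: (@leq_trans ((x m).+1 * radix_weight m)).
  by rewrite mulSn ltn_add2r.
by rewrite leq_mul2r ltn_ord orbT.
Qed.

(** The value of a block of maximal digits telescopes to one less than the next
    place value, exactly as 99 + 1 = 100. *)
Lemma radix_value_max (m p : nat) (x : odoX) :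
  first_nonmax x = Some p -> (m <= p)%N ->
  (radix_value m x).+1 = radix_weight m.
Proof.
move=> /first_nonmaxP[_ xmax]; elim: m => [|m IHm] mp.
  by rewrite /radix_value /radix_weight !big_ord0.
rewrite radix_valueS -addSn IHm ?(ltnW mp)// radix_weightS.
have -> : x m = (2 ^ m.+1 - 1)%N :> nat.
  apply/eqP; rewrite eqn_leq [X in _ && X]leqNgt xmax// andbT.
  by rewrite -ltnS subn1 prednK ?expn_gt0.
by rewrite -mulSn subn1 prednK ?expn_gt0// mulnC.
Qed.

(** The digits below the carry position drop from their maximal value, one less
    than the next place value, to 0, while the digit at the carry position gains
    one. *)
Lemma radix_value_odometer (m p : nat) (x : odoX) :
  first_nonmax x = Some p -> (p < m)%N ->
  radix_value m (odometer x) = (radix_value m x).+1.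
Proof.
move=> xp; elim: m => // m IHm; rewrite ltnS leq_eqVlt => /predU1P[pm|pm].
  rewrite !radix_valueS -pm (odometer_eq xp) -addSn (radix_value_max xp)//.
  rewrite {1}/radix_value big1 ?add0n ?mulSn// => i _.
  by rewrite (odometer_lt xp).
by rewrite !radix_valueS IHm// (odometer_gt xp)// addSn.
Qed.

(** * Growth of the products of factorials *)

Lemma superfactS (n : nat) : superfact n.+1 = (superfact n * n.+1`!)%N.
Proof. by rewrite /superfact big_nat_recr. Qed.

Lemma superfact_gt0 (n : nat) : (0 < superfact n)%N.
Proof. by apply: prodn_gt0 => i; exact: fact_gt0. Qed.

Lemma leq_superfact : {homo superfact : m n / (m <= n)%N}.
Proof.
apply: homo_leq => [//|m n p|n]; first exact: leq_trans.
by rewrite superfactS leq_pmulr// fact_gt0.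
Qed.

Lemma superfact_geq (n : nat) : (n <= superfact n)%N.
Proof.
case: n => // n; rewrite superfactS (leq_trans (fact_geq _))//.
by rewrite leq_pmull// superfact_gt0.
Qed.

(** The factors 2, 4, ..., 2 ^ m of the left-hand side are distinct factors of
    the factorial. This is the growth comparison behind the whole argument: when
    the carry stops at digit [m], the roof takes a value K_M with M >= 2 ^ m.+2.
    It exceeds the next smaller value by the factor M!, which by this lemma is at
    least [radix_weight m.+2], whereas smaller terms can accumulate over fewer
    than [radix_weight m.+1] steps. *)
Lemma radix_weight_le_fact (m : nat) : (radix_weight m <= (2 ^ m)`!)%N.
Proof.
elim: m => [|m IHm]; first by rewrite /radix_weight big_ord0.
rewrite radix_weightS -(prednK (expn_gt0 2 m.+1)) factS mulnC.
rewrite prednK ?expn_gt0// leq_mul2l (leq_trans IHm) ?orbT//.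
apply: leq_fact.
by rewrite -ltnS prednK ?expn_gt0// ltn_exp2l.
Qed.

Lemma superfact_bracket (R : realType) (M0 : nat) (w : R) :
  (superfact M0)%:R <= w ->
  exists M, [/\ (M0 <= M)%N, (superfact M)%:R <= w
              & w < (superfact M.+1)%:R].
Proof.
move=> M0w; pose P n := (M0 <= n)%N && (w < (superfact n.+1)%:R).
have exP : exists n, P n.
  exists (M0 + Num.truncn w)%N; rewrite /P leq_addr/=.
  have w0 : 0 <= w by rewrite (le_trans _ M0w).
  have /andP[_ wlt] := truncn_itv w0.
  rewrite (lt_le_trans wlt)// ler_nat (leq_trans (superfact_geq _))//.
  by rewrite leq_superfact// ltnS leq_addl.
case: (ex_minnP exP) => M /andP[M0M wM] Mmin; exists M; split=> //.
move: M0M; rewrite leq_eqVlt => /predU1P[<-//|].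
case: M {wM} Mmin => // M Mmin; rewrite ltnS => M0M.
rewrite leNgt; apply/negP => wM.
by have := Mmin M; rewrite /P M0M wM ltnn => /(_ isT).
Qed.

(** Every index of a value of the roof determines the position of the carry and
    the digit that follows it. *)
Lemma dyadic_split (m0 M : nat) : (2 ^ m0.+2 <= M)%N ->
  exists m j, [/\ (m0 <= m)%N, (j < 2 ^ m.+2)%N & M = (2 ^ m.+2 + j)%N].
Proof.
move=> m0M.
have M0 : (0 < M)%N by rewrite (leq_trans _ m0M)// expn_gt0.
have m0t : (m0.+2 <= trunc_log 2 M)%N by apply: trunc_log_max.
have /andP[tM Mt] := trunc_log_bounds (isT : (1 < 2)%N) M0.
case: (trunc_log 2 M) m0t tM Mt => [|[|m]]// m0m tM Mt.
exists m, (M - 2 ^ m.+2)%N; rewrite subnKC//; split=> //.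
by rewrite ltn_subLR// addnn -mul2n -expnS.
Qed.

Lemma dyadic_index_le (p q m j : nat) : (j < 2 ^ m)%N ->
  (2 ^ p + q <= 2 ^ m + j)%N -> (p <= m)%N.
Proof.
move=> jm pm; rewrite -ltnS -(ltn_exp2l _ _ (isT : (1 < 2)%N)).
apply: (leq_ltn_trans (leq_trans (leq_addr _ _) pm)).
by rewrite (expnS 2 m) mul2n -addnn ltn_add2l.
Qed.

(** * Sums of the roof along orbits *)

Lemma roofE (R : realType) (x : odoX) (p : nat) : first_nonmax x = Some p ->
  roof R x = (superfact (2 ^ p.+2 + x p.+1))%:R.
Proof. by rewrite /roof => ->. Qed.

Lemma roof_ge1 (R : realType) (x : odoX) : 1 <= roof R x.
Proof.
by rewrite /roof; case: first_nonmax => [p|]; rewrite ler1n superfact_gt0.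
Qed.

Lemma roof_le_height (R : realType) (x : odoX) (k i : nat) : (i < k)%N ->
  roof R (iter i odometer x) <= height odometer (@roof R) k x.
Proof.
move=> ik; rewrite /height (bigD1 (Ordinal ik))//= lerDl sumr_ge0// => l _.
by rewrite (le_trans ler01)// roof_ge1.
Qed.

(** Orbits that start here never meet the all-maximal point, where the odometer
    resets every digit at once and the roof is small although the carry has run
    through all digits. The set has full measure, and it is defined by the tail
    of the digits so as to be visibly stable under the odometer. *)
Definition inf_nonmax : set odoX :=
  [set x | forall n, exists2 i, (n <= i)%N & (x i < 2 ^ i.+1 - 1)%N].

Lemma inf_nonmax_first (x : odoX) : inf_nonmax x ->
  exists p, first_nonmax x = Some p.
Proof.
rewrite /first_nonmax => /(_ 0%N)[i _ xi].
by case: pselect => [e|[]]; [exists (ex_minn e)|exists i].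
Qed.

Lemma inf_nonmax_odometer (x : odoX) : inf_nonmax x -> inf_nonmax (odometer x).
Proof.
move=> xinf n; have [p xp] := inf_nonmax_first xinf.
have [i ni xi] := xinf (maxn n p.+1).
move: ni; rewrite geq_max => /andP[ni pi]; exists i => //.
by rewrite (odometer_gt xp).
Qed.

Lemma inf_nonmax_iter (x : odoX) (k : nat) :
  inf_nonmax x -> inf_nonmax (iter k odometer x).
Proof. by move=> xinf; elim: k => //= k; exact: inf_nonmax_odometer. Qed.

(** As long as no carry leaves the first [m.+1] digits, these count the steps and
    the next digit does not move. *)
Lemma no_carry_run (x : odoX) (m k : nat) :
  (forall i, (i < k)%N ->
    exists2 p, first_nonmax (iter i odometer x) = Some p & (p <= m)%N) ->
  forall i, (i <= k)%N ->
    radix_value m.+1 (iter i odometer x) = (radix_value m.+1 x + i)%N /\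
    iter i odometer x m.+1 = x m.+1.
Proof.
move=> run; elim=> [|i IHi] ik; first by rewrite addn0.
have [IHv IHd] := IHi (ltnW ik); have [p xp pm] := run i ik.
rewrite iterS (radix_value_odometer xp)// IHv addnS; split=> //.
by rewrite (odometer_gt xp).
Qed.

(** Suppose that the sum S of [k] roof values lies within a factor [D] below [w],
    and that K_M is the largest roof value not exceeding [w]. No term of S
    exceeds K_M, so no carry goes beyond digit [m], the sum has fewer than
    [radix_weight m.+1] terms, and digit [m.+1] is constant along the orbit
    segment. If this digit is not [j], then K_M itself does not occur, all terms
    are at most K_(M-1) = K_M / M!, and since M! is at least [radix_weight m.+2],
    that is, [radix_weight m.+1] times 2 ^ m.+2, the sum is smaller than
    K_M / D: a contradiction. The conclusion is stated along the whole segment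
    because forward returns need it at its start and backward returns at its
    end. *)
Lemma leading_term_digit (R : realType) (x : odoX) (k m j : nat) (w D : R) :
  inf_nonmax x -> (j < 2 ^ m.+2)%N -> D <= 2 ^+ m.+2 ->
  (superfact (2 ^ m.+2 + j))%:R <= w -> w < (superfact (2 ^ m.+2 + j).+1)%:R ->
  w <= D * height odometer (@roof R) k x ->
  height odometer (@roof R) k x <= w ->
  forall i, (i <= k)%N -> iter i odometer x m.+1 = j :> nat.
Proof.
set M := (2 ^ m.+2 + j)%N; set S := height _ _ _ _.
move=> xinf jm Dm Mw wM wS Sw.
have index_le i : (i < k)%N -> exists p,
    first_nonmax (iter i odometer x) = Some p /\
    (2 ^ p.+2 + iter i odometer x p.+1 <= M)%N.
  move=> ik; have [p xp] := inf_nonmax_first (inf_nonmax_iter i xinf).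
  exists p; split=> //; rewrite leqNgt; apply/negP => /leq_superfact.
  rewrite leqNgt => /negP; apply.
  rewrite -(ltr_nat R) -(roofE R xp).
  exact: le_lt_trans (roof_le_height R x ik) (le_lt_trans Sw wM).
(* An index up to M < 2 ^ m.+3 forces the carry to stop at digit m or before. *)
have run i : (i < k)%N ->
    exists2 p, first_nonmax (iter i odometer x) = Some p & (p <= m)%N.
  move=> /index_le[p [xp pM]]; exists p => //.
  exact: (dyadic_index_le jm pM).
have fixed := no_carry_run run.
move=> i ik; rewrite (fixed i ik).2; apply/eqP/negPn/negP => xj.
(* The first m.+1 digits have counted k steps without overflowing. *)
have khm : (k < radix_weight m.+1)%N.
  have := radix_value_lt m.+1 (iter k odometer x).
  by rewrite (fixed k (leqnn k)).1; exact/leq_ltn_trans/leq_addl.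
have M0 : (0 < M)%N by rewrite addn_gt0 expn_gt0.
(* An index equal to M would decode to p = m and to a digit equal to j. *)
have termlt l : (l < k)%N ->
    roof R (iter l odometer x) <= (superfact M.-1)%:R.
  move=> lk; have [p [xp pM]] := index_le l lk.
  rewrite (roofE R xp) ler_nat leq_superfact// -ltnS prednK//.
  rewrite ltn_neqAle pM andbT; apply/negP => /eqP eM.
  have pm : p = m.
    have [p'] := run l lk; rewrite xp => -[<-]{p'} pm.
    apply/eqP; rewrite eqn_leq pm/=.
    by apply: (@dyadic_index_le m.+2 j p.+2 _ (ltn_ord _)); rewrite -/M -eM.
  move: eM; rewrite pm => /eqP; rewrite eqn_add2l.
  by rewrite (fixed l (ltnW lk)).2 (negbTE xj).
have SK : S <= k%:R * (superfact M.-1)%:R.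
  rewrite /S /height mulr_natl -[k in leRHS]card_ord -sumr_const.
  by apply: ler_sum => l _; exact: termlt.
have K0 : 0 < (superfact M.-1)%:R :> R by rewrite ltr0n superfact_gt0.
have D0 : 0 < D.
  rewrite ltNge; apply/negP => D0.
  have : w <= 0.
    rewrite (le_trans wS)// mulr_le0_ge0// sumr_ge0// => l _.
    by rewrite (le_trans ler01)// roof_ge1.
  by rewrite leNgt (lt_le_trans _ Mw)// ltr0n superfact_gt0.
have factM : (radix_weight m.+2 <= M`!)%N.
  by rewrite (leq_trans (radix_weight_le_fact _))// leq_fact// leq_addr.
have : w < w.
  rewrite (le_lt_trans wS)//.
  rewrite (@lt_le_trans _ _
    (D * ((radix_weight m.+1)%:R * (superfact M.-1)%:R)))//.
    by rewrite ltr_pM2l// (le_lt_trans SK)// ltr_pM2r// ltr_nat.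
  apply: le_trans Mw; rewrite -(prednK M0) superfactS prednK// natrM.
  rewrite mulrA mulrC ler_pM2l// (@le_trans _ _ (radix_weight m.+2)%:R)//.
    by rewrite (radix_weightS m.+1) natrM mulrC ler_wpM2l// natrX.
  by rewrite ler_nat.
by rewrite ltxx.
Qed.

(** * Measures of digit events and of strips *)

Lemma digit_weightT (R : realType) (n : nat) :
  digit_weight R [set: 'I_(2 ^ n.+1)]%SET = 1.
Proof.
rewrite /digit_weight sumr_const cardsT card_ord -[LHS]mulr_natl natrX.
by rewrite mulfV// expf_neq0// pnatr_eq0.
Qed.

Lemma product_measureT (R : realType) (mu : {measure set odoX -> \bar R}) :
  is_product_measure mu -> mu setT = 1%E.
Proof.
move=> mu_prod.
have := mu_prod 0 (fun=> [set: _]%SET); rewrite big_ord0 => <-.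
by congr (mu _); apply/seteqP; split.
Qed.

(** Prescribing all digits below [m] freely turns the finite-dimensional formula
    into the law of the single digit [m]. *)
Lemma product_measure_digit (R : realType) (mu : {measure set odoX -> \bar R})
    (m j : nat) : is_product_measure mu -> (j < 2 ^ m.+1)%N ->
  mu [set x | x m = j :> nat] = (2 ^- m.+1)%:E.
Proof.
move=> mu_prod jm.
pose B i : {set 'I_(2 ^ i.+1)} :=
    [set c : 'I_(2 ^ i.+1) | (i == m) ==> (c == j :> nat)]%SET.
have := mu_prod m.+1 B.
rewrite big_ord_recr/= big1 ?mul1r => [|i _]; last first.
  rewrite -(digit_weightT R i); congr digit_weight.
  by apply/setP => c; rewrite !inE ltn_eqF.
have -> : B m = [set Ordinal jm]%SET.
  by apply/setP => c; rewrite !inE eqxx.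
rewrite /digit_weight big_set1 => <-; congr (mu _).
apply/seteqP; split => x /=.
  move=> xj i; rewrite ltnS inE => im; apply/implyP => /eqP.
  by move: xj => /[swap] -> ->.
by move=> /(_ m (ltnSn m)); rewrite inE eqxx => /eqP.
Qed.

Lemma measurable_inf_nonmax : measurable inf_nonmax.
Proof.
rewrite (_ : inf_nonmax = \bigcap_n \bigcup_(i in [set i | (n <= i)%N])
    [set x : odoX | (x i < 2 ^ i.+1 - 1)%N]).
  apply: bigcap_measurableType => n _; apply: bigcup_measurable => i _.
  exact: (measurable_digit [set j : 'I_(2 ^ i.+1) | (j < 2 ^ i.+1 - 1)%N]).
apply/seteqP; split=> x /=.
  by move=> xinf n _; have [i ni xi] := xinf n; exists i.
by move=> xinf n; have [i ni xi] := xinf n I; exists i.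
Qed.

Lemma exp2V_small (R : realType) (e : R) : 0 < e ->
  exists n0, forall n, (n0 <= n)%N -> 2 ^- n <= e.
Proof.
move=> e0; have [n0 _ hn] := near_infty_natSinv_expn_lt (PosNum e0).
by exists n0 => n /hn/= /ltW; rewrite div1r.
Qed.

(** A point outside [inf_nonmax] has maximal digits from some position on, which is
    less likely than any one of those digits being maximal. *)
Lemma product_measure_inf_nonmax (R : realType)
    (mu : {measure set odoX -> \bar R}) :
  is_product_measure mu -> mu inf_nonmax = 1%E.
Proof.
move=> mu_prod.
pose E n :=
    [set x : odoX | forall i, (n <= i)%N -> x i = (2 ^ i.+1 - 1)%N :> nat].
have Cinf : ~` inf_nonmax `<=` \bigcup_n E n.
  move=> x /existsNP[n xn]; exists n => // i ni.
  apply/eqP; rewrite eqn_leq [X in _ && X]leqNgt.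
  rewrite -ltnS [X in _ && X](_ : _ = true) ?andbT.
    by rewrite subn1 prednK ?expn_gt0.
  by apply/negP => xi; apply: xn; exists i.
have mC : measurable (~` inf_nonmax).
  by apply: measurableC; exact: measurable_inf_nonmax.
have nullC : mu (~` inf_nonmax) = 0%E.
  apply/(negligibleP _ mC)/(negligibleS Cinf)/negligible_bigcup => n.
  have mD i j : measurable [set x : odoX | x i = j :> nat].
    exact: (measurable_digit [set c : 'I_(2 ^ i.+1) | c = j :> nat]).
  have mE : measurable (E n).
    rewrite (_ : E n = \bigcap_(i in [set i | (n <= i)%N])
        [set x : odoX | x i = (2 ^ i.+1 - 1)%N :> nat]).
      by apply: bigcap_measurableType => i _; exact: mD.
    by apply/seteqP; split.
  apply/(negligibleP _ mE)/eqP; rewrite eq_le measure_ge0 andbT.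
  apply/lee_addgt0Pr => e e0; rewrite add0e.
  have [n0 n0e] := exp2V_small e0.
  apply: (@le_trans _ _ (2 ^- (maxn n n0).+1)%:E); last first.
    by rewrite lee_fin n0e// (leq_trans (leq_maxr n n0)).
  rewrite -(@product_measure_digit _ mu _ (2 ^ (maxn n n0).+1 - 1)%N mu_prod);
    last by rewrite subn1 prednK ?expn_gt0.
  apply: le_measure; [exact: mem_set|by apply: mem_set; exact: mD|].
  by move=> x; apply; exact: leq_maxl.
have muU : (mu setT = mu inf_nonmax + mu (~` inf_nonmax))%E.
  rewrite -(setUv inf_nonmax); apply: measureU => //; last exact: setICr.
  exact: measurable_inf_nonmax.
by rewrite -(product_measureT mu_prod) muU nullC adde0.
Qed.

(** The roof is at least 1, so strips of height 1 lie in the suspension and carry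
    a product measure. *)
Lemma suspension_measure_strip (R : realType) (mu : {measure set odoX -> \bar R})
    (B : set odoX) : measurable B ->
  suspension_measure mu (@measurable_roof R)
    (B `*` (`]0, 1[%classic : set R)) = mu B.
Proof.
move=> mB; rewrite /suspension_measure /= /mrestr setIidl.
  have itv1 : lebesgue_measure (`]0, 1[%classic : set R) = 1%E.
    by rewrite lebesgue_measure_itv/= lte_fin ltr01 sube0.
  rewrite (product_measure1E mu lebesgue_measure mB (measurable_itv _)).
  by rewrite [X in (_ * X)%E]itv1 mule1.
move=> [x u] [/= _]; rewrite in_itv/= /suspension/= => /andP[u0 u1].
by rewrite (ltW u0)/= (lt_le_trans u1)// roof_ge1.
Qed.

(** * Returns to the base box *)

Lemma pinv_notin (aT : pointedType) (rT : Type) (A : set aT) (f : aT -> rT)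
  (y : rT) : ~ (f @` A) y -> pinv A f y = point.
Proof.
move=> ny.
have -> : pinv A f y = odflt point (if pselect ((f @` A) y) is left By
    then Some (projT1 (cid2 By)) else None) by [].
by case: pselect.
Qed.

(** Starting the interval strictly above 0 keeps out the point (all-zero, 0), which
    is the default value of the inverse defining the flow at negative times. *)
Definition base_box (R : realType) : set (odoX * R) :=
  inf_nonmax `*` `]0, 1[%classic.

(** Both second coordinates lie in an interval of length 1, so a forward return
    time differs by less than 1 from a sum of the roof. *)
Lemma flow_fwd_base (R : realType) (t : R) (y : odoX * R) :
  base_box y -> base_box (flow_fwd odometer (@roof R) t y) ->
  exists k, (flow_fwd odometer (@roof R) t y).1 = iter k odometer y.1 /\
    t - 1 < height odometer (@roof R) k y.1 < t + 1.
Proof.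
rewrite /flow_fwd => -[_ /=]; rewrite in_itv/= => /andP[y0 y1].
set k := flow_level _ _ _ _ => -[_ /=]; rewrite in_itv/= => /andP[z0 z1].
by exists k; split=> //; apply/andP; split; lra.
Qed.

(** A backward return is a forward return read from its endpoint. *)
Lemma flow_neg_base (R : realType) (t : R) (y : odoX * R) : t < 0 ->
  base_box (flow odometer (@roof R) t y) ->
  flow_fwd odometer (@roof R) (- t) (flow odometer (@roof R) t y) = y.
Proof.
move=> t0; rewrite /flow ltNge (ltW t0)/= lt_eqF// => Az.
have [yim|ynim] := pselect
    ((flow_fwd odometer (@roof R) (- t) @` suspension (@roof R)) y).
  by rewrite pinvK// inE.
by move: Az; rewrite (pinv_notin ynim) => -[_] /=; rewrite in_itv/= ltxx.
Qed.

(** With a = exp (s - delta) and b = exp (s + delta), a return time of absolute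
    value between a and b gives a sum of the roof between a - 1 and b + 1, hence
    between a / 2 and 2 b when a >= 2. These bounds are in the ratio
    4 exp (2 delta), whatever [s] is. For a forward return [y] is the start of the
    orbit segment that realizes the sum, for a backward return its end. *)
Lemma return_digit (R : realType) (delta s t : R) (m j : nat) (y : odoX * R) :
  0 < delta -> 2 <= expR (s - delta) ->
  (j < 2 ^ m.+2)%N -> 4 * expR (2 * delta) <= 2 ^+ m.+2 ->
  (superfact (2 ^ m.+2 + j))%:R <= 2 * expR (s + delta) ->
  2 * expR (s + delta) < (superfact (2 ^ m.+2 + j).+1)%:R ->
  (expR (s - delta) < t < expR (s + delta) \/
   - expR (s + delta) < t < - expR (s - delta)) ->
  base_box y -> base_box (flow odometer (@roof R) t y) ->
  y.1 m.+1 = j :> nat.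
Proof.
move=> d0 a2 jm Dm Mw wM ht Ay Az.
have eb : expR (s + delta) = expR (s - delta) * expR (2 * delta).
  by rewrite -expRD; congr expR; lra.
have ab : expR (s - delta) <= expR (s + delta) by rewrite ler_expR; lra.
have hh (tau h : R) : expR (s - delta) < tau < expR (s + delta) ->
    tau - 1 < h < tau + 1 ->
    2 * expR (s + delta) <= 4 * expR (2 * delta) * h /\
    h <= 2 * expR (s + delta).
  move=> /andP[ta tb] /andP[h1 h2]; split; last by lra.
  have -> : 2 * expR (s + delta) =
      4 * expR (2 * delta) * (expR (s - delta) / 2).
    by rewrite eb; lra.
  rewrite ler_wpM2l ?mulr_ge0 ?expR_ge0//; lra.
case: ht => ht.
  have t0 : 0 < t by move: ht => /andP[ta _]; rewrite (lt_trans _ ta)// expR_gt0.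
  move: Az; rewrite /flow t0 => /(flow_fwd_base Ay)[k [_ hk]].
  have [h1 h2] := hh _ _ ht hk.
  exact: (leading_term_digit Ay.1 jm Dm Mw wM h1 h2 (leq0n k)).
have t0 : t < 0.
  by move: ht => /andP[_ tb]; rewrite (lt_trans tb)// oppr_lt0 expR_gt0.
have zy := flow_neg_base t0 Az.
set z := flow _ _ _ _ in Az zy.
have Azy : base_box (flow_fwd odometer (@roof R) (- t) z) by rewrite zy.
have [k [yk hk]] := flow_fwd_base Az Azy.
have ht' : expR (s - delta) < - t < expR (s + delta).
  by move: ht => /andP[ta tb]; apply/andP; split; lra.
have [h1 h2] := hh _ _ ht' hk.
rewrite /= -[y]zy yk.
exact: (leading_term_digit Az.1 jm Dm Mw wM h1 h2 (leqnn k)).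
Qed.

(** * Property B *)

Theorem corollary5p4 (R : realType) (mu : {measure set odoX -> \bar R})
    (mu_prod : is_product_measure mu) :
  property_B (suspension_measure mu (@measurable_roof R))
    (suspension (@roof R)) (flow odometer (@roof R)).
Proof.
exists (@base_box R); split.
- apply: measurableX; first exact: measurable_inf_nonmax.
  exact: measurable_itv.
- move=> [x u] [/= _]; rewrite in_itv/= /suspension/= => /andP[u0 u1].
  by rewrite (ltW u0)/= (lt_le_trans u1)// roof_ge1.
- rewrite suspension_measure_strip; last exact: measurable_inf_nonmax.
  by rewrite product_measure_inf_nonmax.
move=> delta d0; set nu := suspension_measure _ _.
have small (e : R) : 0 < e -> exists s0, forall s, s0 < s ->
    (mu_ext nu (return_set (flow odometer (@roof R)) delta s (@base_box R))
      <= e%:E)%E.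
  move=> e0; have [n1 n1e] := exp2V_small e0.
  have D0 : 0 < (4 * expR (2 * delta))^-1 by rewrite invr_gt0 mulr_gt0// expR_gt0.
  have [n2 n2D] := exp2V_small D0.
  (* n1 makes the measure of the strip small, and n2 makes 2 ^ m.+2 exceed the
     ratio 4 exp (2 delta) of the window. *)
  pose m0 := maxn n1 n2.
  exists (Num.max (delta + 1) (superfact (2 ^ m0.+2))%:R) => s.
  rewrite gt_max => /andP[sd sK].
  have a2 : 2 <= expR (s - delta).
    by apply: le_trans (expR_ge1Dx _); lra.
  have wK : (superfact (2 ^ m0.+2))%:R <= 2 * expR (s + delta).
    have := expR_ge1Dx (s + delta); have := expR_gt0 (s + delta).
    by move: (superfact_gt0 (2 ^ m0.+2)); rewrite -(ltr_nat R); lra.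
  have [M [M0 Mw wM]] := superfact_bracket wK.
  have [m [j [m0m jm eM]]] := dyadic_split M0.
  rewrite eM in Mw wM.
  have m2 : (m0 <= m.+2)%N by rewrite (leq_trans m0m)// ltnW.
  have Dm : 4 * expR (2 * delta) <= 2 ^+ m.+2.
    have := n2D _ (leq_trans (leq_maxr n1 n2) m2).
    by rewrite lef_pV2// posrE; [rewrite exprn_gt0|rewrite mulr_gt0 ?expR_gt0].
  pose D := [set x : odoX | x m.+1 = j :> nat].
  have mD : measurable D.
    exact: (measurable_digit [set c : 'I_(2 ^ m.+2) | c = j :> nat]).
  have nuD : mu_ext nu (D `*` (`]0, 1[%classic : set R)) = (2 ^- m.+2)%:E.
    have mstrip : measurable (D `*` (`]0, 1[%classic : set (measurableTypeR R))).
      by apply: measurableX => //; exact: measurable_itv.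
    have -> := measurable_mu_extE nu mstrip.
    by rewrite [LHS]suspension_measure_strip// product_measure_digit.
  apply: (@le_trans _ _ (2 ^- m.+2)%:E).
    rewrite -nuD; apply: le_mu_ext => y [Ay [t [ht Az]]].
    by split; [exact: return_digit d0 a2 jm Dm Mw wM ht Ay Az|case: Ay].
  by rewrite lee_fin; exact: n1e (leq_trans (leq_maxl n1 n2) m2).
apply/eqP; rewrite eq_le; apply/andP; split; last first.
  apply: limf_esup_ge0 => [[M [_ hM]]|s]; last exact: mu_ext_ge0.
  by apply: (hM (M + 1)); rewrite ltrDl.
apply/lee_addgt0Pr => e e0; rewrite add0e limf_esupE.
have [s0 hs] := small e e0.
apply: (@le_trans _ _ (ereal_sup ((fun s : R => mu_ext nu
    (return_set (flow odometer (@roof R)) delta s (@base_box R)))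
    @` [set s | s0 < s]))).
  apply: ereal_inf_lbound; exists [set s | s0 < s] => //.
  by exists s0; split=> //; exact: num_real.
by apply: ge_ereal_sup => _ [s /= /hs + <-].
Qed.
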